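(* Let $n\ge 1$ and $m\ge 1$ be integers and let $H_m(\mathbb B)$ be the analytic functional Hilbert space on the open unit ball $\mathbb B\subset\mathbb C^n$ with reproducing kernel $K_m(z,w)=(1-\langle z,w\rangle)^{-m}$. Let $T\in L(H_m(\mathbb B))$ be a bounded linear operator satisfying \[ M^{\prime *}_zTM^\prime_z = P_{{\rm Im}M^*_z}\Big(\oplus \sum^{m-1}_{j=0}(-1)^j\binom{m}{j+1}\sigma^j_{M_z}(T)\Big)P_{{\rm Im}M^*_z}. \] Let $T_0=\frac{1}{2\pi}\int_0^{2\pi}U(t)TU(t)^*\,dt$ and define \[ g=(T-T_0)(1),\qquad h=T^*(1). \] Then $T$ is a Toeplitz operator with pluriharmonic symbol $f=g+\overline{h}$, i.e. $Tp=T_gp+T_h^*p$ for all polynomials $p\in\mathbb C[z]$.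
   Context: $H_m(\mathbb B)=\{f=\sum_{\alpha\in\mathbb N^n}f_\alpha z^\alpha\in\mathcal O(\mathbb B):\ \|f\|^2=\sum_\alpha |f_\alpha|^2/\rho_m(\alpha)<\infty\}$ with $\rho_m(\alpha)=\frac{(m+|\alpha|-1)!}{\alpha!(m-1)!}$; the monomials are orthogonal and polynomials are dense. Let $\mathbb H_k$ denote the space of homogeneous polynomials of degree $k$, so $H_m(\mathbb B)$ is the orthogonal sum of the $\mathbb H_k$, and every $f$ has homogeneous expansion $f=\sum_k f_k$, $f_k\in\mathbb H_k$. $M_z:H_m(\mathbb B)^n\to H_m(\mathbb B)$, $(f_i)\mapsto\sum_i z_if_i$, is the row multiplication operator (it has closed range), $M_z^*:H_m(\mathbb B)\to H_m(\mathbb B)^n$, $f\mapsto (M_{z_i}^*f)_i$, is its adjoint, and $P_{{\rm Im}M_z^*}$ is the orthogonal projection of $H_m(\mathbb B)^n$ onto the closed range of $M_z^*$. Let $\delta\in L(H_m(\mathbb B))$ be the diagonal operator $\delta(\sum_k f_k)=f_0+\sum_{k\ge1}\frac{m+k-1}{k}f_k$, and define $M_z'=\delta M_z:H_m(\mathbb B)^n\to H_m(\mathbb B)$, with adjoint $M_z'^*$. For $X\in L(H_m(\mathbb B))$, $\sigma_{M_z}(X)=\sum_{i=1}^n M_{z_i}XM_{z_i}^*$, $\sigma^j_{M_z}$ is its $j$-th iterate ($\sigma^0_{M_z}(X)=X$), and $\oplus X$ denotes the operator $X\oplus\cdots\oplus X$ ($n$ copies) on $H_m(\mathbb B)^n$.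 $U(t)\in L(H_m(\mathbb B))$ is the unitary $(U(t)f)(z)=f(e^{it}z)$, $t\in\mathbb R$; the integral defining $T_0$ is a weak operator integral (i.e. $\langle T_0f,g\rangle=\frac1{2\pi}\int_0^{2\pi}\langle U(t)TU(t)^*f,g\rangle dt$). For $u\in H_m(\mathbb B)$, $T_u$ denotes the densely defined closed multiplication operator $D_u\to H_m(\mathbb B)$, $v\mapsto uv$, with domain $D_u=\{v\in H_m(\mathbb B): uv\in H_m(\mathbb B)\}\supset\mathbb C[z]$, and $T_u^*$ its Hilbert space adjoint; the polynomials lie in the domain of $T_u^*$ and $T_u^*z^\alpha=\sum_{0\le\beta\le\alpha}\frac{\rho_m(\alpha-\beta)}{\rho_m(\alpha)}\overline{u_\beta}z^{\alpha-\beta}$. A bounded operator $T$ on $H_m(\mathbb B)$ is called a Toeplitz operator with pluriharmonic symbol $f$ if there are $g,h\in H_m(\mathbb B)$ with $f=g+\overline h$ and $Tp=T_gp+T_h^*p$ for all $p\in\mathbb C[z]$. *)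

(* Defs.v *)
From HB Require Import structures.
From mathcomp Require Import all_boot all_order all_algebra.
From mathcomp Require Import all_classical all_reals all_analysis.
From mathcomp Require Import complex.
Set Implicit Arguments. Unset Strict Implicit. Unset Printing Implicit Defensive.
Import Order.TTheory GRing.Theory Num.Theory.
Import numFieldNormedType.Exports.
Local Open Scope classical_set_scope.
Local Open Scope ring_scope.

(* Coefficient model of H_m(B): an element f = sum_alpha f_alpha z^alpha is
   represented by its family of Taylor coefficients (mi n -> R[i]). *)

Definition mi (n : nat) := {ffun 'I_n -> nat}.
Definition mdeg n (a : mi n) : nat := (\sum_(i < n) a i)%N.
Definition mfact n (a : mi n) : nat := (\prod_(i < n) (a i)`!)%N.
Definition hser (R : realType) (n : nat) := mi n -> R[i].
Definition hvser (R : realType) (n : nat) := 'I_n -> hser R n.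

Section Hm.
Variables (R : realType) (n m : nat).
Local Notation C := R[i].
Local Notation S := (hser R n).
Local Notation V := (hvser R n).

Definition rho (a : mi n) : R :=
  ((m + mdeg a).-1)`!%:R / ((mfact a * (m.-1)`!)%N)%:R.

Definition normsqH (f : S) : \bar R :=
  \esum_(a in [set: mi n]) ((ComplexField.Normc.normc (f a)) ^+ 2 / rho a)%:E.
Definition inH (f : S) : Prop := (normsqH f < +oo)%E.
Definition normH (f : S) : R := Num.sqrt (fine (normsqH f)).

Definition rsum (T : choiceType) (u : T -> R) : R :=
  fine (\esum_(x in [set: T]) (Num.max (u x) 0)%:E)
  - fine (\esum_(x in [set: T]) (Num.max (- u x) 0)%:E).
Definition csum (T : choiceType) (u : T -> C) : C :=
  Complex (rsum (fun x => complex.Re (u x))) (rsum (fun x => complex.Im (u x))).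

Definition ipH (f g : S) : C :=
  csum (fun a => f a * conjc (g a) / (Complex (rho a) 0)).

Definition inHn (F : V) : Prop := forall i, inH (F i).
Definition ipHn (F G : V) : C := \sum_(i < n) ipH (F i) (G i).
Definition normHn (F : V) : R := Num.sqrt (\sum_(i < n) fine (normsqH (F i))).

(* bounded linear operators on H_m(B) (only their action on H_m(B) matters) *)
Definition isBoundedOp (T : S -> S) : Prop :=
  [/\ forall f, inH f -> inH (T f),
      forall (c : C) f g, inH f -> inH g ->
        T (fun a => c * f a + g a) = (fun a => c * T f a + T g a)
    & exists K : R, forall f, inH f -> normH (T f) <= K * normH f].

Definition isAdjointH (T Ts : S -> S) : Prop :=
  (forall g, inH g -> inH (Ts g)) /\
  (forall f g, inH f -> inH g -> ipH (T f) g = ipH f (Ts g)).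
Definition isAdjointVH (A : V -> S) (B : S -> V) : Prop :=
  (forall g, inH g -> inHn (B g)) /\
  (forall F g, inHn F -> inH g -> ipH (A F) g = ipHn F (B g)).

Definition mi_pred (i : 'I_n) (a : mi n) : mi n :=
  [ffun j => if j == i then (a j).-1 else a j].
Definition mulz (i : 'I_n) (f : S) : S :=
  fun a => if (0 < a i)%N then f (mi_pred i a) else 0.
Definition Mz (F : V) : S := fun a => \sum_(i < n) mulz i (F i) a.
Definition delta (f : S) : S :=
  fun a => if mdeg a == 0%N then f a
           else ((m + mdeg a).-1)%:R / (mdeg a)%:R * f a.
Definition Mz' (F : V) : S := delta (Mz F).

(* sigma_{M_z}(X) = sum_i M_{z_i} X M_{z_i}^*, where M_{z_i}^* f = (M_z^* f)_i *)
Definition sigmaMz (Mzs : S -> V) (X : S -> S) : S -> S :=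
  fun f a => \sum_(i < n) mulz i (X (Mzs f i)) a.
Definition Ssum (Mzs : S -> V) (T : S -> S) : S -> S :=
  fun f a => \sum_(j < m) ((-1) ^+ j * ('C(m, j.+1))%:R) * iter j (sigmaMz Mzs) T f a.
Definition oplus (X : S -> S) : V -> V := fun F i => X (F i).

Definition isOrthProjRange (B : S -> V) (P : V -> V) : Prop :=
  forall F, inHn F ->
    [/\ inHn (P F),
        (forall e : R, 0 < e -> exists g, inH g /\
            normHn (fun i a => P F i a - B g i a) < e)
      & forall g, inH g -> ipHn (fun i a => F i a - P F i a) (B g) = 0].

(* (U(t) f)(z) = f(e^{it} z) *)
Definition Ut (t : R) (f : S) : S :=
  fun a => Complex (cos (t * (mdeg a)%:R)) (sin (t * (mdeg a)%:R)) * f a.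
Definition cint (phi : R -> C) : C :=
  Complex (\int[lebesgue_measure]_(t in `[0, 2 * pi]) complex.Re (phi t))
          (\int[lebesgue_measure]_(t in `[0, 2 * pi]) complex.Im (phi t)).
(* T0 = (1/2pi) int_0^{2pi} U(t) T U(t)^* dt  (weak integral; U(t)^* = U(-t)) *)
Definition isWeakAvg (T T0 : S -> S) : Prop :=
  forall f g, inH f -> inH g ->
    ipH (T0 f) g = (Complex (1 / (2 * pi)) 0) * cint (fun t => ipH (Ut t (T (Ut (- t) f))) g).

Definition hone : S := fun a => if mdeg a == 0%N then 1 else 0.
Definition smul (u v : S) : S :=
  fun a => (\sum_(b \in [set b : mi n | forall i, (b i <= a i)%N])
              u b * v [ffun i => (a i - b i)%N])%R.
Definition isPoly (p : S) : Prop := finite_set [set a | p a != 0].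
(* w = T_u^* p, where T_u : D_u -> H, v |-> u v, D_u = {v in H | u v in H} *)
Definition isTstarMul (u p w : S) : Prop :=
  inH w /\ forall v, inH v -> inH (smul u v) -> ipH (smul u v) p = ipH v w.

End Hm.

(* Main.v *)
Require Import Defs.
From HB Require Import structures.
From mathcomp Require Import all_boot all_order all_algebra.
From mathcomp Require Import all_classical all_reals all_analysis.
From mathcomp Require Import complex.
From mathcomp Require Import ring lra zify.
Import Order.TTheory GRing.Theory Num.Theory.
Import numFieldNormedType.Exports.
Local Open Scope ring_scope.
Local Open Scope classical_set_scope.
Set Implicit Arguments.
Unset Strict Implicit.
Unset Printing Implicit Defensive.

(* Let A(a,b) = rho(b) * (T z^b)_a.  As delta M_z M_z^* is the projection onto
   the functions vanishing at 0, compressing the hypothesis by M_z^* turns it into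
   (1 - sigma)^m T = T - (1 - P_C) T (1 - P_C).  On the matrices A, sigma acts
   as the diagonal shift A(a,b) |-> sum_i A(a - e_i, b - e_i), that is, as
   multiplication of sum A(a,b) x^a y^b by <x,y>.  Hence this generating series
   is (1 - <x,y>)^-m times its part with a = 0 or b = 0, so that A(a,b) is
   rho(min(a,b)) times the entry of A at (a - min(a,b), b - min(a,b)) if a and b
   are comparable, and 0 otherwise.  These are the coefficients of
   T_g + T_h^*, the first column of A giving g and the first row giving h. *)

(** * Arithmetic of multi-indices *)

Section MultiIndex.
Variable n : nat.
Implicit Types (a b : mi n) (i j : 'I_n).

Definition mi0 : mi n := [ffun => 0%N].
Definition mi_succ i a : mi n := [ffun j => if j == i then (a j).+1 else a j].
Definition mi_sub a b : mi n := [ffun i => (a i - b i)%N].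
Definition mi_min a b : mi n := [ffun i => minn (a i) (b i)].

Lemma mi_predK i a : (0 < a i)%N -> mi_succ i (mi_pred i a) = a.
Proof.
by move=> ai; apply/ffunP => j; rewrite !ffunE; case: eqP => // ->; rewrite prednK.
Qed.

Lemma mi_succK i a : mi_pred i (mi_succ i a) = a.
Proof. by apply/ffunP => j; rewrite !ffunE; case: eqP. Qed.

Lemma mi_succ_gt0 i a : (0 < mi_succ i a i)%N.
Proof. by rewrite ffunE eqxx. Qed.

Lemma mi_succ_eq i a b : (mi_succ i a == b) = (0 < b i)%N && (a == mi_pred i b).
Proof.
apply/eqP/andP => [<-|[bi /eqP ->]]; first by rewrite mi_succ_gt0 mi_succK.
exact: mi_predK.
Qed.

Lemma mdeg_succ i a : mdeg (mi_succ i a) = (mdeg a).+1.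
Proof.
rewrite /mdeg (bigD1 i)//= [in RHS](bigD1 i)//= ffunE eqxx addSn.
by congr (_ + _).+1; apply: eq_bigr => j /negPf ji; rewrite ffunE ji.
Qed.

Lemma mdeg_pred i a : (0 < a i)%N -> mdeg a = (mdeg (mi_pred i a)).+1.
Proof. by move=> ai; rewrite -(mdeg_succ i) mi_predK. Qed.

Lemma mfact_succ i a : mfact (mi_succ i a) = ((a i).+1 * mfact a)%N.
Proof.
rewrite /mfact (bigD1 i)//= [in RHS](bigD1 i)//= ffunE eqxx factS mulnA.
by congr (_ * _)%N; apply: eq_bigr => j /negPf ji; rewrite ffunE ji.
Qed.

Lemma mfact_pred i a : (0 < a i)%N -> mfact a = (a i * mfact (mi_pred i a))%N.
Proof. by move=> ai; rewrite -{1}(mi_predK ai) mfact_succ ffunE eqxx prednK. Qed.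

Lemma mfact_gt0 a : (0 < mfact a)%N.
Proof. by apply: prodn_gt0 => i; exact: fact_gt0. Qed.

Lemma mdeg_eq0 a : (mdeg a == 0%N) = (a == mi0).
Proof.
rewrite /mdeg sum_nat_eq0; apply/forallP/eqP => [h|-> i]; last by rewrite ffunE.
by apply/ffunP => i; rewrite ffunE; apply/eqP; exact: h.
Qed.

Lemma mdeg_gt0 a : (0 < mdeg a)%N = (a != mi0).
Proof. by rewrite lt0n mdeg_eq0. Qed.

Lemma mi_neq0P a : a != mi0 -> exists i, (0 < a i)%N.
Proof.
move=> a0; apply/existsP; apply: contra_neqT a0 => /existsPn h.
by apply/ffunP => i; rewrite ffunE; apply/eqP; have := h i; rewrite -eqn0Ngt.
Qed.

Lemma mi_min_pred i a b : (0 < a i)%N -> (0 < b i)%N ->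
  mi_min (mi_pred i a) (mi_pred i b) = mi_pred i (mi_min a b).
Proof.
by move=> ai bi; apply/ffunP => j; rewrite !ffunE; case: eqP => // ->; lia.
Qed.

Lemma mi_sub_pred i a b : (0 < a i)%N -> (0 < b i)%N ->
  mi_sub (mi_pred i a) (mi_pred i b) = mi_sub a b.
Proof.
by move=> ai bi; apply/ffunP => j; rewrite !ffunE; case: eqP => // ->; lia.
Qed.

End MultiIndex.
Arguments mi0 {n}.

(** * The weights [rho] as coefficients of powers of the kernel *)

Section Weights.
Variables (R : realType) (n : nat).
Local Notation C := R[i].
Implicit Types (a b : mi n) (i : 'I_n).

Definition rhoC m a : C := Complex (rho R m a) 0.

(* The coefficient of x^a y^a in (1 - <x,y>)^-k, which also makes sense for
   k = 0. *)
Definition binom_weight k a : C :=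
  'C((k + mdeg a).-1, mdeg a)%:R * (mdeg a)`!%:R / (mfact a)%:R.

Lemma mfactC_neq0 a : (mfact a)%:R != 0 :> C.
Proof. by rewrite pnatr_eq0 -lt0n mfact_gt0. Qed.

Lemma factC_neq0 k : k`!%:R != 0 :> C.
Proof. by rewrite pnatr_eq0 -lt0n fact_gt0. Qed.

Lemma rho_gt0 m a : 0 < rho R m a.
Proof.
by rewrite divr_gt0// ltr0n ?muln_gt0 ?mfact_gt0 fact_gt0.
Qed.

Lemma rhoCE m a : rhoC m a = ((m + mdeg a).-1)`!%:R / (mfact a * (m.-1)`!)%:R.
Proof.
have natC k : k%:R = real_complex R k%:R by rewrite rmorph_nat.
by rewrite !natC -fmorphV -rmorphM.
Qed.

Lemma rhoC_neq0 m a : rhoC m a != 0.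
Proof.
by rewrite rhoCE natrM mulf_neq0 ?invr_neq0 ?mulf_neq0 ?factC_neq0 ?mfactC_neq0.
Qed.

(** The quotient (m+|a|-1)! / (m-1)! is the binomial coefficient of m+|a|-1 over |a|, times |a|!. *)
Lemma rhoC_weight m a : (0 < m)%N -> rhoC m a = binom_weight m a.
Proof.
move=> m0; rewrite rhoCE /binom_weight.
have le : (mdeg a <= (m + mdeg a).-1)%N by lia.
rewrite -(bin_fact le) (_ : ((m + mdeg a).-1 - mdeg a)%N = m.-1); last by lia.
rewrite !natrM; have := mfactC_neq0 a; have := factC_neq0 m.-1.
by move=> h1 h2; field; rewrite h1 h2.
Qed.

Lemma rhoC0 m : (0 < m)%N -> rhoC m (@mi0 n) = 1.
Proof.
move=> m0; have d0 : mdeg (@mi0 n) = 0%N by apply/eqP; rewrite mdeg_eq0.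
have f0 : mfact (@mi0 n) = 1%N.
  by rewrite /mfact big1// => i _; rewrite ffunE.
by rewrite rhoC_weight// /binom_weight d0 f0 bin0 fact0 !mul1r invr1.
Qed.

(** The zeroth power of the kernel is 1. For a nonzero the binomial coefficient of |a|-1 over |a|
    vanishes, and at a = 0 the truncated predecessor leaves that of 0 over 0. *)
Lemma weight0 a : binom_weight 0 a = (a == mi0)%:R.
Proof.
rewrite /binom_weight; have [->|/[dup] a0] := eqVneq a mi0.
  have := rhoC0 (m:=1) isT; rewrite rhoC_weight// /binom_weight.
  have /eqP -> : mdeg (@mi0 n) == 0%N by rewrite mdeg_eq0.
  by rewrite !bin0.
by rewrite -mdeg_gt0 => ?; rewrite bin_small ?mul0r//; lia.
Qed.

Lemma natr_sum_mdeg a : \sum_i (a i)%:R = (mdeg a)%:R :> C.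
Proof. by rewrite natr_sum. Qed.

Lemma rhoC_pred m i a : (0 < m)%N -> (0 < a i)%N ->
  rhoC m (mi_pred i a) / rhoC m a = (a i)%:R / ((m + mdeg a).-1)%:R.
Proof.
move=> m0 ai; rewrite !rhoCE (mfact_pred ai) (mdeg_pred ai).
rewrite addnS /= -{2}(prednK (n := m + mdeg (mi_pred i a))); last by lia.
rewrite factS prednK; last by lia.
rewrite !natrM; set k := (m + _)%N.
have k0 : k%:R != 0 :> C by rewrite pnatr_eq0; lia.
have h1 := mfactC_neq0 (mi_pred i a); have h2 := factC_neq0 m.-1.
have h3 := factC_neq0 k.-1.
have h4 : (a i)%:R != 0 :> C by rewrite pnatr_eq0 -lt0n.
by field; rewrite k0 h1 h2 h3 h4.
Qed.

(** Multiplying (1 - <x,y>)^-(k+1) by 1 - <x,y> lowers the exponent by one. On coefficients, the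
    term at a - e_i is a_i times a factor independent of i; since the a_i add up to |a|, what
    remains is Pascal's rule. *)
Lemma weight_rec k a :
  binom_weight k.+1 a -
  \sum_i (if (0 < a i)%N then binom_weight k.+1 (mi_pred i a) else 0)
  = binom_weight k a.
Proof.
have [a0|a0] := posnP (mdeg a).
  rewrite big1 ?subr0 => [|i _]; last first.
    move/eqP: a0; rewrite mdeg_eq0 => /eqP ->; by rewrite ffunE.
  by rewrite /binom_weight a0 !bin0.
have [N aN] : exists N, mdeg a = N.+1 by exists (mdeg a).-1; lia.
rewrite (eq_bigr (fun i => 'C(k + N, N)%:R * N`!%:R / (mfact a)%:R * (a i)%:R)).
  rewrite -mulr_sumr natr_sum_mdeg /binom_weight aN factS.
  rewrite (_ : (k.+1 + N.+1).-1 = (k + N).+1)%N; last by lia.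
  rewrite (_ : (k + N.+1).-1 = k + N)%N; last by lia.
  by rewrite binS natrD natrM; ring.
move=> i _; case: ifP => ai; last first.
  by rewrite (_ : a i = 0%N) ?mulr0//; lia.
have := aN; rewrite (mdeg_pred ai) => -[dN].
rewrite /binom_weight dN (_ : (k.+1 + N).-1 = k + N)%N; last by lia.
rewrite (mfact_pred ai) natrM.
have h1 := mfactC_neq0 (mi_pred i a).
have h4 : (a i)%:R != 0 :> C by rewrite pnatr_eq0 -lt0n.
by field; rewrite h1 h4.
Qed.

(** * The diagonal difference equation *)

Definition diag_shift (A : mi n -> mi n -> C) a b : C :=
  \sum_i (if (0 < a i)%N && (0 < b i)%N then A (mi_pred i a) (mi_pred i b) else 0).

Definition diag_diff (A : mi n -> mi n -> C) a b : C := A a b - diag_shift A a b.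

(** The shift at (a, b) reads only entries whose first index has degree |a|-1, so [A] is recovered
    from its difference by induction on |a|. *)
Lemma diag_diff_inj : injective diag_diff.
Proof.
move=> A B AB; apply/funext => a; apply/funext => b.
move: {2}(mdeg a).+1 (ltnSn (mdeg a)) => N; elim: N => // N IH in a b *.
move=> aN; have := congr1 (fun X => X a b) AB; rewrite /diag_diff.
suff -> : diag_shift A a b = diag_shift B a b by move/addIr.
apply: eq_bigr => i _; case: ifP => // /andP[ai _]; apply: IH.
by move: aN; rewrite (mdeg_pred ai) ltnS.
Qed.

Lemma iter_diag_shift_sub j A B :
  iter j diag_shift (fun a b => A a b - B a b) =
  (fun a b => iter j diag_shift A a b - iter j diag_shift B a b).
Proof.
elim: j => //= j ->; apply/funext => a; apply/funext => b.
by rewrite /diag_shift -sumrB; apply: eq_bigr => i _; case: ifP; rewrite ?subr0.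
Qed.

(** Induction step in the binomial expansion of (1 - shift)^m, where u j stands for an entry of the
    j-th shift; it combines Pascal's rule with summation by parts. *)
Lemma binomial_difference m (u : nat -> C) :
  \sum_(j < m.+1) (-1) ^+ j * 'C(m, j)%:R * (u j - u j.+1) =
  \sum_(j < m.+2) (-1) ^+ j * 'C(m.+1, j)%:R * u j.
Proof.
rewrite [RHS]big_ord_recl bin0.
under [X in _ = _ + X]eq_bigr => j _ do rewrite lift0 binS natrD exprS.
rewrite (eq_bigr (fun j : 'I_m.+1 => (-1) ^+ j * 'C(m, j)%:R * u j -
   (-1) ^+ j * 'C(m, j)%:R * u j.+1)); last by move=> j _; ring.
rewrite sumrB [X in X - _]big_ord_recl bin0 -addrA; congr (_ + _).
rewrite [in RHS](eq_bigr (fun j : 'I_m.+1 => (-1) ^+ j.+1 * 'C(m, j.+1)%:R * u j.+1 -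
   (-1) ^+ j * 'C(m, j)%:R * u j.+1)); last by move=> j _; rewrite exprS; ring.
rewrite sumrB; congr (_ - _); rewrite [RHS]big_ord_recr /= bin_small//.
by rewrite mulr0 mul0r addr0.
Qed.

Lemma iter_diag_diff m A a b :
  iter m diag_diff A a b =
  \sum_(j < m.+1) (-1) ^+ j * 'C(m, j)%:R * iter j diag_shift A a b.
Proof.
elim: m A => [|m IH] A.
  by rewrite big_ord1 bin0 expr0 !mul1r.
rewrite iterSr IH -(binomial_difference m (fun j => iter j diag_shift A a b)).
apply: eq_bigr => j _; congr (_ * _).
by rewrite iter_diag_shift_sub -iterSr.
Qed.

(* The candidate solution of (1 - diag_shift)^k A = c. Its generating series is
   (1 - <x,y>)^-k times that of the part of c supported on disjoint pairs. *)
Definition diag_sol k (c : mi n -> mi n -> C) a b : C :=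
  binom_weight k (mi_min a b) * c (mi_sub a b) (mi_sub b a).

(** Passing from (a, b) to (a - e_i, b - e_i) fixes both truncated differences and lowers the
    minimum by e_i, so only the weight changes and [weight_rec] applies. *)
Lemma diag_diff_sol k c : diag_diff (diag_sol k.+1 c) = diag_sol k c.
Proof.
apply/funext => a; apply/funext => b.
rewrite /diag_sol -weight_rec mulrBl mulr_suml; congr (_ - _).
apply: eq_bigr => i _; rewrite ffunE leq_min.
case: ifP => [/andP[ai bi]|]; last by rewrite mul0r.
by rewrite mi_min_pred// !mi_sub_pred.
Qed.

(** Uniqueness of the solution: one difference is cancelled at a time by injectivity. *)
Lemma iter_diag_diff_sol k A c :
  iter k diag_diff A = diag_sol 0 c -> A = diag_sol k c.
Proof.
elim: k A => [|k IH] A; first by [].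
by rewrite iterSr => /IH; rewrite -diag_diff_sol => /diag_diff_inj.
Qed.

Lemma diag_sol_boundary m (A : mi n -> mi n -> C) :
  (forall a b, \sum_(j < m.+1) (-1) ^+ j * 'C(m, j)%:R * iter j diag_shift A a b =
     if (a == mi0) || (b == mi0) then A a b else 0) ->
  A = diag_sol m (fun a b => if (a == mi0) || (b == mi0) then A a b else 0).
Proof.
move=> hA; apply: iter_diag_diff_sol.
apply/funext => a; apply/funext => b; rewrite iter_diag_diff hA /diag_sol weight0.
(* A zero minimum means disjoint supports, and then the truncated differences give back a and b.
   Every pair with a = 0 or b = 0 is of this kind, so the other case contributes 0 on both sides. *)
have [ab|ab] := eqVneq (mi_min a b) mi0.
  have ab0 i : minn (a i) (b i) = 0%N.
    by have := congr1 (fun f : mi n => f i) ab; rewrite !ffunE.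
  have -> : mi_sub a b = a.
    by apply/ffunP => i; rewrite ffunE; move: (a i) (b i) (ab0 i) => x y; lia.
  have -> : mi_sub b a = b.
    by apply/ffunP => i; rewrite ffunE; move: (a i) (b i) (ab0 i) => x y; lia.
  by rewrite mul1r.
rewrite mul0r; case: ifP => // /orP[]/eqP z; case/eqP: ab; apply/ffunP => i.
  by rewrite z !ffunE min0n.
by rewrite z !ffunE minn0.
Qed.

End Weights.

(** * Complex moduli and sums of finite support *)

Local Notation normc := ComplexField.Normc.normc.

Lemma normc_le_add (R : realType) (x y : R[i]) : normc (x + y) <= normc x + normc y.
Proof. by rewrite -lecR rmorphD; exact: (@ler_normD _ R[i]). Qed.

Lemma normc_ge0 (R : realType) (x : R[i]) : 0 <= normc x.
Proof. by case: x => a b; exact: sqrtr_ge0. Qed.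

Lemma conjcM (R : realType) (x y : R[i]) : conjc (x * y) = conjc x * conjc y.
Proof. exact: rmorphM. Qed.

Lemma conjcV (R : realType) (x : R[i]) : conjc x^-1 = (conjc x)^-1.
Proof. exact: fmorphV. Qed.

Lemma conjc_sum (R : realType) (J : Type) (s : seq J) (F : J -> R[i]) :
  conjc (\sum_(j <- s) F j) = \sum_(j <- s) conjc (F j).
Proof. exact: raddf_sum. Qed.

Section FiniteSums.
Variables (R : realType) (T : choiceType).

Lemma esum_seq (u : T -> R) (s : seq T) : uniq s ->
  (forall x, 0 <= u x) -> (forall x, x \notin s -> u x = 0) ->
  \esum_(x in [set: T]) (u x)%:E = (\sum_(x <- s) u x)%:E.
Proof.
move=> us u0 uN.
have -> : \esum_(x in [set: T]) (u x)%:E = \esum_(x in [set` s]) (u x)%:E.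
  rewrite [RHS]esum_mkcond; apply: eq_esum => x _.
  case: ifPn => //; rewrite notin_setE /= => /negP xs.
  by rewrite uN.
rewrite esum_fset//; last by move=> x _; rewrite lee_fin.
by rewrite -(fsbig_seq _ _ us) sumEFin.
Qed.

Lemma rsum_seq (u : T -> R) (s : seq T) : uniq s ->
  (forall x, x \notin s -> u x = 0) -> rsum u = \sum_(x <- s) u x.
Proof.
move=> us uN; rewrite /rsum !(esum_seq us)/=.
- rewrite -sumrB; apply: eq_bigr => x _.
  rewrite !maxEle; case: ifP => h1; case: ifP => h2; move: h1 h2; lra.
- by move=> x; rewrite le_max lexx orbT.
- by move=> x /uN ->; rewrite oppr0 maxxx.
- by move=> x; rewrite le_max lexx orbT.
- by move=> x /uN ->; rewrite maxxx.
Qed.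

Lemma csum_seq (u : T -> R[i]) (s : seq T) : uniq s ->
  (forall x, x \notin s -> u x = 0) -> csum u = \sum_(x <- s) u x.
Proof.
move=> us uN; rewrite /csum !(rsum_seq us)/=; try by move=> x /uN ->.
elim: s {us uN} => [|x s IH]; first by rewrite !big_nil.
by rewrite !big_cons -IH; case: (u x).
Qed.

End FiniteSums.

(** * Membership in the space, monomials and coefficient bounds *)

Section Space.
Variables (R : realType) (n m : nat).
Local Notation C := R[i].
Local Notation S := (hser R n).
Local Notation inH := (@Defs.inH R n m).
Implicit Types (f g : S) (a b : mi n) (i : 'I_n).

Lemma rhoC_real a : rhoC R m a = (rho R m a)%:C%C.
Proof. by []. Qed.

Lemma conjc_rhoC a : conjc (rhoC R m a) = rhoC R m a.
Proof. exact: conjc_real. Qed.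

Definition monomial b : S := fun a => (a == b)%:R.

Lemma hone_mon : @hone R n = monomial mi0.
Proof. by apply/funext => a; rewrite /hone /monomial mdeg_eq0; case: eqP. Qed.

(** Every inner product evaluated below has a polynomial on one side, so it reduces to a finite sum
    and raises no question of convergence. *)
Lemma ipH_seq (s : seq (mi n)) f g : uniq s ->
  (forall a, a \notin s -> f a = 0 \/ g a = 0) ->
  ipH m f g = \sum_(a <- s) f a * conjc (g a) / rhoC R m a.
Proof.
move=> us h; apply: csum_seq => // a /h[] ->; first by rewrite !mul0r.
by rewrite conjc0 mulr0 mul0r.
Qed.

Lemma ipH_monr f b : ipH m f (monomial b) = f b / rhoC R m b.
Proof.
rewrite (@ipH_seq [:: b])// => [|a].
  by rewrite big_seq1 /monomial eqxx conjc1 mulr1.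
by rewrite inE /monomial => /negPf ->; right.
Qed.

Lemma ipH_monl f b : ipH m (monomial b) f = conjc (f b) / rhoC R m b.
Proof.
rewrite (@ipH_seq [:: b])// => [|a].
  by rewrite big_seq1 /monomial eqxx mul1r.
by rewrite inE /monomial => /negPf ->; left.
Qed.

Let sq f a : R := (normc (f a)) ^+ 2 / rho R m a.

Lemma normsqH_coef_ge0 f a : 0 <= sq f a.
Proof. by rewrite divr_ge0 ?sqr_ge0// ltW// rho_gt0. Qed.

Lemma inH_seq (s : seq (mi n)) f : (forall a, a \notin s -> f a = 0) -> inH f.
Proof.
move=> h; rewrite /Defs.inH /normsqH (@esum_seq _ _ (sq f) (undup s)) ?ltry ?undup_uniq//.
  exact: normsqH_coef_ge0.
move=> a; rewrite mem_undup => /h fa.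
by rewrite /sq fa ComplexField.Normc.normc0 expr0n mul0r.
Qed.

Lemma inH_mon b : inH (monomial b).
Proof.
by apply: (@inH_seq [:: b]) => a; rewrite inE /monomial => /negPf ->.
Qed.

Lemma inH0 : inH (fun=> 0).
Proof. by apply: (@inH_seq [::]). Qed.

Lemma esum_mul (T : choiceType) (u : T -> R) (c : R) : 0 <= c ->
  (forall x, 0 <= u x) ->
  (\esum_(x in [set: T]) (u x)%:E < +oo)%E ->
  (\esum_(x in [set: T]) (c * u x)%:E < +oo)%E.
Proof.
move=> c0 u0 uoo.
apply: (@le_lt_trans _ _ (c%:E * \esum_(x in [set: T]) (u x)%:E)%E).
  rewrite ge_ereal_sup => //= _ [X [finX _]] <-.
  rewrite (_ : (\sum_(x \in X) (c * u x)%:E)%E = (c%:E * \sum_(x \in X) (u x)%:E)%E).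
    by apply: lee_wpmul2l; rewrite ?lee_fin//; apply: esum_ge; exists X.
  by rewrite !fsbig_finite// !sumEFin -EFinM mulr_sumr.
have fin : (\esum_(x in [set: T]) (u x)%:E)%E \is a fin_num.
  by rewrite ge0_fin_numE//; apply: esum_ge0 => x _; rewrite lee_fin.
by rewrite -(fineK fin) -EFinM ltry.
Qed.

Lemma inH_lin (c : C) f g : inH f -> inH g -> inH (fun a => c * f a + g a).
Proof.
move=> hf hg; rewrite /Defs.inH /normsqH.
set k := normc c.
(* Termwise majorant from |x + y|^2 <= 2 |x|^2 + 2 |y|^2. *)
pose u a := 2 * k ^+ 2 * sq f a; pose v a := 2 * sq g a.
apply: (@le_lt_trans _ _ (\esum_(a in [set: mi n]) ((u a)%:E + (v a)%:E)%E)).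
  apply: le_esum => a _; rewrite -EFinD lee_fin /u /v /sq.
  rewrite !mulrA -mulrDl ler_wpM2r ?invr_ge0 ?(ltW (rho_gt0 _ _ _))//.
  have := normc_le_add (c * f a) (g a).
  rewrite ComplexField.Normc.normcM -/k.
  set x := normc (f a); set y := normc (g a).
  set z := normc _ => zle.
  have z0 : 0 <= z by exact: normc_ge0.
  have := sqr_ge0 (k * x - y); nra.
rewrite esumD => [| a _ | a _].
- apply: lte_add_pinfty; apply: esum_mul => //; try exact: normsqH_coef_ge0.
  by rewrite mulr_ge0// sqr_ge0.
- by rewrite lee_fin (mulr_ge0 _ (normsqH_coef_ge0 f a))// mulr_ge0// sqr_ge0.
- by rewrite lee_fin (mulr_ge0 _ (normsqH_coef_ge0 g a)).
Qed.

Lemma inHB f g : inH f -> inH g -> inH (fun a => f a - g a).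
Proof.
move=> hf hg; rewrite (_ : (fun a => _) = (fun a => (-1) * g a + f a)).
  exact: inH_lin.
by apply/funext => a; rewrite mulN1r addrC.
Qed.

Lemma inH_sum (J : Type) (s : seq J) (c : J -> C) (F : J -> S) :
  (forall j, inH (F j)) -> inH (fun a => \sum_(j <- s) c j * F j a).
Proof.
move=> hF; elim: s => [|j s IH].
  rewrite (_ : (fun a => _) = (fun=> 0)); first exact: inH0.
  by apply/funext => a; rewrite big_nil.
rewrite (_ : (fun a => _) = (fun a => c j * F j a + \sum_(j <- s) c j * F j a)).
  exact: inH_lin.
by apply/funext => a; rewrite big_cons.
Qed.

(** The ratio of the two weights is a_i / (m+|a|-1), which is at most 1. This is why multiplication
    by z_i does not increase the norm. *)
Lemma rho_pred_le i a : (0 < m)%N -> (0 < a i)%N ->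
  rho R m (mi_pred i a) <= rho R m a.
Proof.
move=> m0 ai.
suff : rhoC R m (mi_pred i a) <= rhoC R m a by rewrite !rhoC_real lecR.
have r0 : 0 < rhoC R m a by rewrite rhoC_real ltcR rho_gt0.
have aim : (a i <= (m + mdeg a).-1)%N.
  have : (a i <= mdeg a)%N by rewrite /mdeg (bigD1 i)//= leq_addr.
  by move: (a i) => x; lia.
rewrite -[leLHS](divfK (lt0r_neq0 r0)) rhoC_pred// ler_piMl ?(ltW r0)//.
by rewrite ler_pdivrMr ?mul1r ?ler_nat// ltr0n (leq_trans ai).
Qed.

Lemma inH_mulz i f : (0 < m)%N -> inH f -> inH (mulz i f).
Proof.
move=> m0; rewrite /Defs.inH; apply: le_lt_trans; rewrite /normsqH.
have bij : set_bij [set: mi n] [set a : mi n | (0 < a i)%N] (mi_succ i).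
  split=> [a _|a b _ _ e|a /= ai]; first exact: mi_succ_gt0.
    by rewrite -(mi_succK i a) e mi_succK.
  by exists (mi_pred i a) => //; exact: mi_predK.
apply: (@le_trans _ _ (\esum_(a in [set a : mi n | (0 < a i)%N]) (sq (mulz i f) a)%:E)).
  rewrite [leRHS]esum_mkcond; apply: le_esum => a _.
  case: ifPn => //; rewrite notin_setE /= => /negP; rewrite -eqn0Ngt => /eqP ai.
  by rewrite /mulz ai ltnn ComplexField.Normc.normc0 expr0n mul0r.
rewrite (reindex_esum [set: mi n] _ _ _ bij); apply: le_esum => a _.
rewrite lee_fin /sq /mulz mi_succ_gt0 mi_succK ler_wpM2l ?sqr_ge0//.
rewrite lef_pV2 ?posrE ?rho_gt0//.
by rewrite -{1}(mi_succK i a) rho_pred_le ?mi_succ_gt0.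
Qed.

Lemma coef_le_normsqH f a : inH f -> sq f a <= fine (normsqH m f).
Proof.
move=> hf; rewrite -lee_fin fineK; last first.
  by rewrite ge0_fin_numE//; apply: esum_ge0 => b _; rewrite lee_fin normsqH_coef_ge0.
apply: esum_ge; exists [set a]; first by split => //; exact: finite_set1.
by rewrite fsbig_set1.
Qed.

(** Coefficients are norm continuous, so linear relations between finitely many of them survive norm
    limits. *)
Lemma coef_le_normHn (F : hvser R n) i a : inHn m F ->
  normc (F i a) <= Num.sqrt (rho R m a) * normHn m F.
Proof.
move=> hF; rewrite -sqrtrM ?(ltW (rho_gt0 _ _ _))//.
set x := normc _.
have x0 : 0 <= x by exact: normc_ge0.
rewrite -(ger0_norm x0) -sqrtr_sqr ler_wsqrtr//.
rewrite mulrC -ler_pdivrMr ?rho_gt0//.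
apply: le_trans (coef_le_normsqH a (hF i)) _.
rewrite [leRHS](bigD1 i)//= lerDl sumr_ge0// => j _.
by rewrite fine_ge0// esum_ge0// => b _; rewrite lee_fin normsqH_coef_ge0.
Qed.

End Space.

(** * Integrals of e^{ikt} over a period *)

Section Fourier.
Variable R : realType.

Lemma is_derive_trig (p q k x : R) : k != 0 ->
  is_derive x (1 : R) (fun t : R => k^-1 * (sin (t * k) * p - cos (t * k) * q))
    (cos (x * k) * p + sin (x * k) * q).
Proof.
move=> k0.
have dk : is_derive x (1 : R) (fun t : R => t * k) k.
  by apply: is_derive_eq; rewrite /= scaler0 add0r /GRing.scale /= mulr1.
have ds := is_derive1_comp (g := fun t : R => t * k) (x := x)
  (is_derive_sin (x * k)) dk.
have dc := is_derive1_comp (g := fun t : R => t * k) (x := x)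
  (is_derive_cos (x * k)) dk.
rewrite /comp in ds dc.
apply: is_derive_eq; rewrite /GRing.scale /=; field.
by [].
Qed.

Lemma continuous_trig (p q k : R) :
  continuous (fun t : R => cos (t * k) * p + sin (t * k) * q : R).
Proof.
move=> x; apply: cvgD; apply: cvgM; try exact: cvg_cst.
  apply: (continuous_comp (f := fun t : R => t * k)); last exact: continuous_cos.
  by apply: cvgM; [exact: cvg_id|exact: cvg_cst].
apply: (continuous_comp (f := fun t : R => t * k)); last exact: continuous_sin.
by apply: cvgM; [exact: cvg_id|exact: cvg_cst].
Qed.

(** The antiderivative is 2 pi-periodic. For c = x + iy, the real and imaginary parts of e^{ikt} c
    are the cases (p, q) = (x, -y) and (y, x). *)
Lemma Rintegral_trig (p q : R) (k : nat) : (0 < k)%N ->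
  \int[lebesgue_measure]_(t in `[0, 2 * pi])
    (cos (t * k%:R) * p + sin (t * k%:R) * q) = 0.
Proof.
move=> k0; have kR : k%:R != 0 :> R by rewrite pnatr_eq0 -lt0n.
pose F (t : R) := k%:R^-1 * (sin (t * k%:R) * p - cos (t * k%:R) * q).
have dF x : is_derive x (1 : R) F (cos (x * k%:R) * p + sin (x * k%:R) * q).
  exact: is_derive_trig.
have cF : continuous F.
  move=> x; apply: differentiable_continuous; apply/derivable1_diffP.
  by case: (dF x).
rewrite /Rintegral (@continuous_FTC2 _ _ F).
- have e : 2 * pi * k%:R = 0 + (pi *+ 2) *+ k :> R.
    by rewrite add0r -[RHS]mulr_natr mulr_natl.
  rewrite /F mul0r e (periodicn (@sinD2pi R)) (periodicn (@cosD2pi R)).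
  by rewrite -EFinB subrr.
- by rewrite mulr_gt0// pi_gt0.
- by apply: continuous_subspaceT; exact: continuous_trig.
- split.
  + by move=> x _; case: (dF x).
  + exact/cvg_at_right_filter/cF.
  + exact/cvg_at_left_filter/cF.
- by move=> x _; rewrite derive1E; exact: derive_val.
Qed.

Lemma cint_exp (c : R[i]) (k : nat) :
  cint (fun t : R => Complex (cos (t * k%:R)) (sin (t * k%:R)) * c) =
  (if k == 0%N then Complex (2 * pi) 0 * c else 0).
Proof.
have [->|k0] := eqVneq k 0%N; last first.
  rewrite -lt0n in k0; case: c => x y; rewrite /cint.
  rewrite -[RHS]/(Complex 0 0); congr Complex.
    apply: etrans (Rintegral_trig x (- y) k0).
    by apply: eq_Rintegral => t _; rewrite mulrN.
  exact: (Rintegral_trig y x k0).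
case: c => x y; rewrite /cint.
have -> : (fun t : R =>
    complex.Re (Complex (cos (t * 0%:R)) (sin (t * 0%:R)) * Complex x y)) = cst x.
  by apply/funext => t /=; rewrite mulr0 cos0 sin0 mul1r mul0r subr0.
have -> : (fun t : R =>
    complex.Im (Complex (cos (t * 0%:R)) (sin (t * 0%:R)) * Complex x y)) = cst y.
  by apply/funext => t /=; rewrite mulr0 cos0 sin0 mul1r mul0r addr0.
rewrite !Rintegral_cst//= lebesgue_measure_itv /= lte_fin mulr_gt0 ?pi_gt0//=.
by congr Complex; rewrite oppr0 addr0 mul0r ?subr0 ?addr0 mulrC.
Qed.

End Fourier.

(** * Linear maps and the adjoints of [Mz] and [Mz'] *)

Section LinearOperators.
Variables (R : realType) (n m : nat).
Hypothesis m0 : (0 < m)%N.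
Local Notation C := R[i].
Local Notation S := (hser R n).
Local Notation V := (hvser R n).
Local Notation inH := (@Defs.inH R n m).
Implicit Types (f g : S) (a b : mi n) (i j : 'I_n) (X : S -> S) (F G : V).
Local Notation rhoC := (rhoC R m).
Local Notation mon := (@monomial R n).

Definition linearH X : Prop :=
  (forall f, inH f -> inH (X f)) /\
  (forall (c : C) f g, inH f -> inH g ->
     X (fun a => c * f a + g a) = (fun a => c * X f a + X g a)).

Lemma linearH0 X : linearH X -> X (fun=> 0) = (fun=> 0).
Proof.
case=> _ /(_ 1 _ _ (inH0 R n m) (inH0 R n m)); set z := X (fun=> 0).
rewrite (_ : (fun a => 1 * 0 + 0) = (fun=> 0)); last first.
  by apply/funext => a; rewrite mulr0 addr0.
rewrite -/z => e; apply/funext => a.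
have /eqP := congr1 (fun f : S => f a) e.
by rewrite /= mul1r -subr_eq0 opprD addrA subrr sub0r oppr_eq0 => /eqP.
Qed.

Lemma linearHZ X c f : linearH X -> inH f ->
  X (fun a => c * f a) = (fun a => c * X f a).
Proof.
move=> lX hf; have [_ /(_ c _ _ hf (inH0 R n m))] := lX.
rewrite (linearH0 lX).
rewrite (_ : (fun a => _ + 0) = (fun a => c * f a)) => [->|].
  by apply/funext => a; rewrite addr0.
by apply/funext => a; rewrite addr0.
Qed.

Lemma linearH_sum X (J : Type) (s : seq J) (c : J -> C) (F : J -> S) :
  linearH X -> (forall k, inH (F k)) ->
  X (fun a => \sum_(k <- s) c k * F k a) = (fun a => \sum_(k <- s) c k * X (F k) a).
Proof.
move=> lX hF; elim: s => [|k s IH].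
  rewrite (_ : (fun a => _) = (fun=> 0)) ?linearH0//.
    by apply/funext => a; rewrite big_nil.
  by apply/funext => a; rewrite big_nil.
rewrite (_ : (fun a => _) = (fun a => c k * F k a + \sum_(k <- s) c k * F k a)).
  have [_ ->] := lX; [|exact: hF|exact: inH_sum].
  by rewrite IH; apply/funext => a; rewrite big_cons.
by apply/funext => a; rewrite big_cons.
Qed.

Definition unitV i a : V := fun j => if j == i then mon a else (fun=> 0).

Lemma inHn_unitV i a : inHn m (unitV i a).
Proof. by move=> j; rewrite /unitV; case: ifP => _; [exact: inH_mon|exact: inH0]. Qed.

Lemma ipHn_unitV i a G : ipHn m (unitV i a) G = conjc (G i a) / rhoC a.
Proof.
rewrite /ipHn (bigD1 i)//= big1 => [|j /negPf ji].
  by rewrite addr0 /unitV eqxx ipH_monl.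
by rewrite /unitV ji (@ipH_seq _ _ _ [::]) ?big_nil// => b; left.
Qed.

Lemma mulz0 i : mulz i (fun=> 0 : C) = (fun=> 0).
Proof. by apply/funext => a; rewrite /mulz; case: ifP. Qed.

Lemma mulz_mon i a : mulz i (mon a) = mon (mi_succ i a).
Proof.
apply/funext => b; rewrite /mulz /monomial [b == _]eq_sym mi_succ_eq [a == _]eq_sym.
by case: ifP.
Qed.

Lemma Mz_unitV i a : Mz (unitV i a) = mon (mi_succ i a).
Proof.
apply/funext => b; rewrite /Mz (bigD1 i)//= big1 => [|j /negPf ji].
  by rewrite addr0 /unitV eqxx mulz_mon.
by rewrite /unitV ji mulz0.
Qed.

(** Testing the adjoint relation on z^a in slot i isolates one coefficient. The scalar d covers both
    [Mz], with d = 1, and [Mz'], with d the multiplier of [delta] in degree |a|+1. *)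
Lemma adjoint_coef (A : V -> S) (B : S -> V) (d : C) g i a :
  isAdjointVH m A B -> inH g ->
  A (unitV i a) = (fun b => d * mon (mi_succ i a) b) ->
  B g i a = conjc d * g (mi_succ i a) * rhoC a / rhoC (mi_succ i a).
Proof.
move=> [_ /(_ (unitV i a) g (inHn_unitV i a))] adj hg Ae; move: (adj hg).
rewrite Ae ipHn_unitV (@ipH_seq _ _ _ [:: mi_succ i a])// => [|b].
  rewrite big_seq1 /monomial eqxx mulr1 => /(congr1 conjc).
  rewrite !(conjcM, conjcV) !conjc_rhoC !conjcK => e.
  have r0 := rhoC_neq0 R m a.
  by rewrite -[LHS](divfK r0) -e; ring.
by rewrite inE /monomial => /negPf ->; left; rewrite mulr0.
Qed.

Variable Mzs : S -> V.
Hypothesis hMzs : isAdjointVH m (@Mz R n) Mzs.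

Lemma Mzs_coef g i a : inH g ->
  Mzs g i a = g (mi_succ i a) * rhoC a / rhoC (mi_succ i a).
Proof.
move=> hg; rewrite (@adjoint_coef _ _ 1 g i a hMzs hg) ?conjc1 ?mul1r//.
by rewrite Mz_unitV; apply/funext => b; rewrite mul1r.
Qed.

Lemma Mzs_coef_pred g i a : inH g -> (0 < a i)%N ->
  Mzs g i (mi_pred i a) = rhoC (mi_pred i a) / rhoC a * g a.
Proof. by move=> hg ai; rewrite Mzs_coef// mi_predK//; ring. Qed.

Lemma Mzs_mon b i : Mzs (mon b) i =
  if (0 < b i)%N then (fun a => rhoC (mi_pred i b) / rhoC b * mon (mi_pred i b) a)
  else (fun=> 0).
Proof.
apply/funext => a; rewrite Mzs_coef; last exact: inH_mon.
rewrite /monomial mi_succ_eq; case: ifP => bi /=; last by rewrite !mul0r.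
case: eqP => [->|_]; last by rewrite !mul0r mulr0.
by rewrite mi_predK//; ring.
Qed.

Lemma sum_rhoC_pred a :
  \sum_i (if (0 < a i)%N then rhoC (mi_pred i a) / rhoC a else 0) =
  (mdeg a)%:R / ((m + mdeg a).-1)%:R.
Proof.
rewrite -natr_sum_mdeg mulr_suml; apply: eq_bigr => i _.
case: ifP => ai; first by rewrite rhoC_pred.
by rewrite (_ : a i = 0%N) ?mul0r//; lia.
Qed.

Definition delta_coef a : C := ((m + mdeg a).-1)%:R / (mdeg a)%:R.

(** The sum is the eigenvalue |a| / (m+|a|-1) of M_z M_z^* on z^a, and [delta] multiplies by its
    inverse. *)
Lemma delta_coefK a : a != mi0 ->
  delta_coef a * \sum_i (if (0 < a i)%N then rhoC (mi_pred i a) / rhoC a else 0) = 1.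
Proof.
rewrite sum_rhoC_pred /delta_coef -mdeg_gt0 => a0.
have h1 : (mdeg a)%:R != 0 :> C by rewrite pnatr_eq0 -lt0n.
have h2 : ((m + mdeg a).-1)%:R != 0 :> C by rewrite pnatr_eq0; lia.
by field; rewrite h1 h2.
Qed.

Lemma Mz_Mzs f a : inH f -> Mz (Mzs f) a =
  (\sum_i (if (0 < a i)%N then rhoC (mi_pred i a) / rhoC a else 0)) * f a.
Proof.
move=> hf; rewrite mulr_suml; apply: eq_bigr => i _.
by rewrite /mulz; case: ifP => ai; rewrite ?mul0r// Mzs_coef_pred.
Qed.

Lemma Mz'_Mzs f : inH f -> Mz' m (Mzs f) = (fun a => if a == mi0 then 0 else f a).
Proof.
move=> hf; apply/funext => a; rewrite /Mz' /delta mdeg_eq0 Mz_Mzs//.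
have [->|a0] := eqVneq a mi0; last by rewrite mulrA delta_coefK ?mul1r.
by rewrite big1 ?mul0r// => i _; rewrite ffunE.
Qed.

(** As [delta] is a real diagonal operator, the adjoint of [Mz'] is M_z^* [delta]; the factor from
    [delta] again cancels the eigenvalue of M_z M_z^*. *)
Lemma Mz_Mzs' (Mzs' : S -> V) f a : isAdjointVH m (Mz' m) Mzs' -> inH f ->
  Mz (Mzs' f) a = if a == mi0 then 0 else f a.
Proof.
move=> hMzs' hf; have [->|a0] := eqVneq a mi0.
  by rewrite /Mz big1// => i _; rewrite /mulz ffunE.
rewrite -[RHS]mul1r -(delta_coefK a0) mulr_sumr mulr_suml; apply: eq_bigr => i _.
rewrite /mulz; case: ifP => ai; last by rewrite mulr0 mul0r.
rewrite (@adjoint_coef _ _ (delta_coef a) f i _ hMzs' hf) ?mi_predK//.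
  by rewrite /delta_coef conjcM conjcV !conjc_nat; ring.
rewrite /Mz' Mz_unitV mi_predK//; apply/funext => b; rewrite /delta /monomial.
by have [->|] := eqVneq b a; rewrite ?mulr0 ?if_same// mdeg_eq0 (negPf a0).
Qed.

(** * The projection onto the range of M_z^* *)

Variable P : V -> V.
Hypothesis hP : isOrthProjRange m Mzs P.

(** G - P G is orthogonal to the range of M_z^*, hence killed by M_z; pairing with monomials reads
    this off coefficient by coefficient. *)
Lemma Mz_proj G : inHn m G -> Mz (P G) = Mz G.
Proof.
move=> hG; have [hPG _ orth] := hP hG; apply/funext => b.
have hD : inHn m (fun i a => G i a - P G i a) by move=> i; exact: inHB.
have := orth _ (inH_mon R m b); have [_ <-//] := hMzs; last exact: inH_mon.
rewrite ipH_monr => /eqP; rewrite mulf_eq0 invr_eq0 (negPf (rhoC_neq0 R m b)) orbF.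
rewrite /Mz (eq_bigr (fun i => mulz i (G i) b - mulz i (P G i) b)).
  by rewrite sumrB subr_eq0 => /eqP ->.
by move=> i _; rewrite /mulz; case: ifP; rewrite ?subrr.
Qed.

(** Both sides equal the coefficient of f at the common successor divided by its weight. *)
Lemma Mzs_compat f i j a b : inH f -> mi_succ i a = mi_succ j b ->
  Mzs f i a / rhoC a = Mzs f j b / rhoC b.
Proof.
move=> hf e; rewrite !Mzs_coef// e.
have := rhoC_neq0 R m a; have := rhoC_neq0 R m b; have := rhoC_neq0 R m (mi_succ j b).
by move=> h1 h2 h3; field; rewrite h1 h2 h3.
Qed.

Lemma normc_eq0_small (z : C) (K : R) : 0 <= K ->
  (forall e, 0 < e -> normc z <= K * e) -> z = 0.
Proof.
move=> K0 h; apply: ComplexField.Normc.eq0_normc; apply/eqP/negPn/negP => z0.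
have zp : 0 < normc z by rewrite lt_neqAle eq_sym z0 normc_ge0.
have K1 : 0 < K + 1 by rewrite ltr_wpDl.
have := h (normc z / (K + 1)) (divr_gt0 zp K1); apply/negP; rewrite -ltNge.
rewrite mulrCA -[ltRHS]mulr1 ltr_pM2l// ltr_pdivrMr// mul1r; lra.
Qed.

(* The relations of [Mzs_compat] cut out the range of M_z^* and only involve
   finitely many coefficients, so they pass to norm limits. *)
Lemma proj_compat G i j a b : inHn m G -> mi_succ i a = mi_succ j b ->
  P G i a / rhoC a = P G j b / rhoC b.
Proof.
move=> hG e; have [hPG appr _] := hP hG; apply/eqP; rewrite -subr_eq0; apply/eqP.
pose K a : R := normc ((rhoC a)^-1) * Num.sqrt (rho R m a).
have K0 c : 0 <= K c by rewrite mulr_ge0 ?normc_ge0 ?sqrtr_ge0.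
apply: (@normc_eq0_small _ (K a + K b)); first exact: addr_ge0.
move=> e' e0; have [f [hf le]] := appr _ e0.
have hD : inHn m (fun i a => P G i a - Mzs f i a).
  by move=> k; apply: inHB => //; apply: (proj1 hMzs).
have -> : P G i a / rhoC a - P G j b / rhoC b =
   (P G i a - Mzs f i a) / rhoC a + - ((P G j b - Mzs f j b) / rhoC b).
  by rewrite !mulrBl (Mzs_compat hf e); ring.
have bnd k c : normc ((P G k c - Mzs f k c) / rhoC c) <= K c * e'.
  rewrite ComplexField.Normc.normcM mulrC /K -mulrA ler_wpM2l ?normc_ge0//.
  apply: le_trans (coef_le_normHn k c hD) _.
  by rewrite ler_wpM2l ?sqrtr_ge0// ltW.
rewrite [leRHS]mulrDl; apply: le_trans (normc_le_add _ _) _; apply: lerD => //.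
rewrite (_ : normc (- _) = normc ((P G j b - Mzs f j b) / rhoC b))//.
by rewrite -mulN1r ComplexField.Normc.normcM (_ : normc (-1) = 1) ?mul1r//=
  oppr0 sqrrN expr1n expr0n addr0 sqrtr1.
Qed.

(** The difference D of the two sides satisfies the compatibility relations and is killed by M_z. By
    the relations, each coefficient of M_z D is a nonzero multiple of any single entry of D
    contributing to it, so D = 0. *)
Lemma proj_Mzs f : inH f -> P (Mzs f) = Mzs f.
Proof.
move=> hf; have hF : inHn m (Mzs f) by apply: (proj1 hMzs).
apply/funext => i; apply/funext => a; apply/eqP; rewrite -subr_eq0; apply/eqP.
set G := Mzs f; pose D i a := P G i a - G i a; rewrite -/(D i a).
have compat j c : mi_succ i a = mi_succ j c -> D j c = rhoC c * (D i a / rhoC a).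
  move=> e; rewrite /D /G [in RHS]mulrBl (proj_compat hF e) (Mzs_compat hf e).
  by have := rhoC_neq0 R m c => r0; field.
set b := mi_succ i a.
have b0 : b != mi0 by rewrite -mdeg_gt0 mdeg_succ.
(* This sum is the coefficient of z^b in M_z D. *)
have : \sum_j (if (0 < b j)%N then D j (mi_pred j b) else 0) = 0.
  rewrite (eq_bigr (fun j => mulz j (P G j) b - mulz j (G j) b)).
    by rewrite sumrB -/(Mz (P G) b) -/(Mz G b) Mz_proj ?subrr.
  by move=> j _; rewrite /mulz; case: ifP; rewrite ?subrr.
rewrite (eq_bigr (fun j => (if (0 < b j)%N then rhoC (mi_pred j b) / rhoC b else 0)
    * (rhoC b * (D i a / rhoC a)))); last first.
  move=> j _; case: ifP => bj; rewrite ?mul0r// (compat j (mi_pred j b)).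
    by have := rhoC_neq0 R m b; have := rhoC_neq0 R m a => r0 r1; field; rewrite r0 r1.
  by rewrite mi_predK.
rewrite -mulr_suml => /(congr1 (fun x => delta_coef b * x)).
rewrite mulrA delta_coefK// mul1r mulr0 => /eqP.
by rewrite !mulf_eq0 invr_eq0 !(negPf (rhoC_neq0 R m _)) orbF => /eqP.
Qed.

(** * The map sigma on coefficient matrices *)

Lemma linearH_sigma X : linearH X -> linearH (sigmaMz Mzs X).
Proof.
move=> lX; have hMf f i : inH f -> inH (Mzs f i) by move=> hf; apply: (proj1 hMzs).
split=> [f hf|c f g hf hg].
  rewrite (_ : sigmaMz Mzs X f = fun a => \sum_i 1 * mulz i (X (Mzs f i)) a).
    by apply: inH_sum => i; apply: inH_mulz => //; apply: (proj1 lX); exact: hMf.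
  by apply/funext => a; apply: eq_bigr => i _; rewrite mul1r.
apply/funext => a; rewrite /sigmaMz mulr_sumr -big_split /=; apply: eq_bigr => i _.
rewrite (_ : Mzs _ i = fun a => c * Mzs f i a + Mzs g i a).
  rewrite (proj2 lX); [|exact: hMf|exact: hMf].
  by rewrite /mulz; case: ifP; rewrite ?mulr0 ?addr0.
by apply/funext => b; rewrite !Mzs_coef//; [ring|exact: inH_lin].
Qed.

Lemma linearH_iter_sigma k X : linearH X -> linearH (iter k (sigmaMz Mzs) X).
Proof. by move=> lX; elim: k => //= k; exact: linearH_sigma. Qed.

(* The scaling by rho turns sigma_{M_z} into a plain diagonal shift. *)
Definition mat X a b : C := rhoC b * X (mon b) a.

(** M_{z_i}^* sends z^b to rho(b - e_i) / rho(b) times z^{b - e_i}; the factor rho(b) in [mat]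
    cancels the denominator and leaves the scaling of column b - e_i. *)
Lemma mat_sigma X : linearH X -> mat (sigmaMz Mzs X) = diag_shift (mat X).
Proof.
move=> lX; apply/funext => a; apply/funext => b.
rewrite /mat /sigmaMz /diag_shift mulr_sumr; apply: eq_bigr => i _.
rewrite Mzs_mon /mulz; case: ifP => ai /=; last by rewrite mulr0.
case: ifP => bi; last by rewrite linearH0// mulr0.
rewrite linearHZ//; last exact: inH_mon.
by have := rhoC_neq0 R m b => r0; field.
Qed.

Lemma mat_iter_sigma k X : linearH X ->
  mat (iter k (sigmaMz Mzs) X) = iter k (@diag_shift R n) (mat X).
Proof.
move=> lX; elim: k => //= k <-; apply: mat_sigma; exact: linearH_iter_sigma.
Qed.

(** One further sigma turns the j-th term of [Ssum] into a multiple of sigma^{j+1} X, so the total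
    is X - (1 - sigma)^m X. *)
Lemma mat_sigma_Ssum X a b : linearH X ->
  rhoC b * sigmaMz Mzs (Ssum m Mzs X) (mon b) a =
  \sum_(k < m) (-1) ^+ k * 'C(m, k.+1)%:R * iter k.+1 (@diag_shift R n) (mat X) a b.
Proof.
move=> lX; transitivity (rhoC b * \sum_(k < m) (-1) ^+ k * 'C(m, k.+1)%:R *
   sigmaMz Mzs (iter k (sigmaMz Mzs) X) (mon b) a).
  congr (_ * _); rewrite /sigmaMz.
  under [RHS]eq_bigr => k _ do rewrite mulr_sumr.
  rewrite exchange_big /=; apply: eq_bigr => i _.
  rewrite {1}/mulz; case: ifP => ai.
    by apply: eq_bigr => k _; rewrite /mulz ai.
  by rewrite big1// => k _; rewrite /mulz ai mulr0.
rewrite mulr_sumr; apply: eq_bigr => k _.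
by rewrite mulrCA -mat_iter_sigma.
Qed.

(** * The operator equation in matrix form *)

Variable T : S -> S.
Hypothesis lT : linearH T.

Lemma inH_Ssum f : inH f -> inH (Ssum m Mzs T f).
Proof. by move=> hf; apply: inH_sum => k; apply: (proj1 (linearH_iter_sigma k lT)). Qed.

Variable Mzs' : S -> V.
Hypothesis hMzs' : isAdjointVH m (Mz' m) Mzs'.
Hypothesis hyp : forall F, inHn m F ->
  Mzs' (T (Mz' m F)) = P (oplus (Ssum m Mzs T) (P F)).

(** The hypothesis is applied to M_z^* z^b, and M_z is then applied to both sides. P disappears
    because it fixes M_z^* z^b and because M_z P = M_z; on the other side [Mz'] and its adjoint
    become the removal of constant terms before and after T. *)
Lemma mat_equation a b :
  rhoC b * sigmaMz Mzs (Ssum m Mzs T) (mon b) a =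
  if (a == mi0) || (b == mi0) then 0 else mat T a b.
Proof.
have hb := inH_mon R m b; have hF : inHn m (Mzs (mon b)) by apply: (proj1 hMzs).
have hG : inHn m (oplus (Ssum m Mzs T) (Mzs (mon b))).
  by move=> i; apply: inH_Ssum; apply: hF.
have := hyp hF; rewrite proj_Mzs// Mz'_Mzs// => /(congr1 (fun F => Mz F a)).
rewrite Mz_proj// => e.
rewrite -[sigmaMz _ _ _ _]/(Mz (oplus (Ssum m Mzs T) (Mzs (mon b))) a) -e.
have [->|b0] := eqVneq b mi0.
  rewrite orbT (_ : (fun c => _) = (fun=> 0)).
    rewrite linearH0// Mz_Mzs'//; last exact: inH0.
    by rewrite if_same mulr0.
  by apply/funext => c; rewrite /monomial; case: eqP.
rewrite orbF (_ : (fun c => _) = mon b); last first.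
  apply/funext => c; rewrite /monomial; case: eqP => // ->.
  by rewrite eq_sym (negPf b0).
rewrite Mz_Mzs'//; last exact: (proj1 lT).
by case: ifP => _; rewrite ?mulr0.
Qed.

Lemma mat_diag_sol :
  mat T = diag_sol m (fun a b => if (a == mi0) || (b == mi0) then mat T a b else 0).
Proof.
apply: diag_sol_boundary => a b.
(* The term j = 0 is the matrix of T itself; the others add up to minus the left side of
   [mat_equation], so only the entries with a = 0 or b = 0 survive. *)
rewrite big_ord_recl bin0 expr0 !mul1r /=.
rewrite (eq_bigr (fun k : 'I_m => - ((-1) ^+ k * 'C(m, k.+1)%:R *
    iter k.+1 (@diag_shift R n) (mat T) a b))).
  by rewrite sumrN -mat_sigma_Ssum// mat_equation; case: ifP; rewrite ?subr0 ?subrr.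
by move=> k _; rewrite /bump leq0n add1n exprS !mulN1r !mulNr.
Qed.

End LinearOperators.

(** * The componentwise order on multi-indices *)

(* [mi_sub b a == mi0] serves as the decidable form of b <= a. *)
Section Order.
Variable n : nat.
Implicit Types (a b c : mi n).

Lemma mi_sub_eq0P a b : reflect (forall i, (b i <= a i)%N) (mi_sub b a == mi0).
Proof.
apply: (iffP eqP) => [e i|h].
  by have := congr1 (fun f : mi n => f i) e; rewrite !ffunE => /eqP; rewrite subn_eq0.
by apply/ffunP => i; rewrite !ffunE; apply/eqP; rewrite subn_eq0.
Qed.

Lemma finite_mi_below a : finite_set [set b : mi n | forall i, (b i <= a i)%N].
Proof.
pose F (f : {ffun 'I_n -> 'I_(mdeg a).+1}) : mi n := [ffun i => val (f i)].
apply: (@sub_finite_set _ _ (F @` setT)); last first.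
  by apply: finite_image; exact: finite_finset.
move=> b /= ba; exists [ffun i => inord (b i)] => //.
apply/ffunP => i; rewrite !ffunE /= inordK// ltnS (leq_trans (ba i))//.
by rewrite /mdeg (bigD1 i)//= leq_addr.
Qed.

Definition below a : seq (mi n) :=
  finmap.enum_fset (fset_set [set b : mi n | forall i, (b i <= a i)%N]).

Lemma below_uniq a : uniq (below a).
Proof. exact: finmap.fset_uniq. Qed.

Lemma mem_below a b : (b \in below a) = (mi_sub b a == mi0).
Proof.
rewrite /below in_fset_set; last exact: finite_mi_below.
by apply/idP/mi_sub_eq0P; rewrite inE.
Qed.

Lemma mi_subK a b : mi_sub b a == mi0 -> mi_sub a (mi_sub a b) = b.
Proof.
move=> /mi_sub_eq0P ba; apply/ffunP => i; rewrite !ffunE.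
by move: (a i) (b i) (ba i) => x y; lia.
Qed.

Lemma mi_sub_below a b : mi_sub (mi_sub a b) a == mi0.
Proof. by apply/mi_sub_eq0P => i; rewrite ffunE leq_subr. Qed.

Lemma mi_min_l a b : mi_sub a b == mi0 -> mi_min a b = a.
Proof.
by move=> /mi_sub_eq0P ab; apply/ffunP => i; rewrite ffunE; apply/minn_idPl.
Qed.

Lemma mi_min_r a b : mi_sub b a == mi0 -> mi_min a b = b.
Proof.
by move=> /mi_sub_eq0P ab; apply/ffunP => i; rewrite ffunE; apply/minn_idPr.
Qed.

Lemma mi_sub0 a : mi_sub a mi0 = a.
Proof. by apply/ffunP => i; rewrite !ffunE subn0. Qed.

(** b |-> a - b is an involution of the indices below a; it swaps the two factors' indices in a
    Cauchy product. *)
Lemma perm_below_sub a : perm_eq (map (mi_sub a) (below a)) (below a).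
Proof.
apply: uniq_perm; rewrite ?below_uniq//.
  rewrite map_inj_in_uniq ?below_uniq// => b c; rewrite !mem_below => hb hc e.
  by rewrite -(mi_subK hb) e mi_subK.
move=> b; apply/mapP/idP => [[c _ ->]|hb]; first by rewrite mem_below mi_sub_below.
exists (mi_sub a b); first by rewrite mem_below mi_sub_below.
by rewrite mi_subK// -mem_below.
Qed.

End Order.

(** * Products with polynomials and the adjoint of multiplication *)

Section Product.
Variables (R : realType) (n m : nat).
Local Notation C := R[i].
Local Notation S := (hser R n).
Local Notation mon := (@monomial R n).
Local Notation rhoC := (rhoC R m).
Local Notation inH := (@Defs.inH R n m).
Implicit Types (u v p : S) (a b : mi n).

Lemma smulE u v a : smul u v a = \sum_(b <- below a) u b * v (mi_sub a b).
Proof. by rewrite /smul fsbig_finite//; exact: finite_mi_below. Qed.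

Lemma smul_mon u a b :
  smul u (mon b) a = if mi_sub b a == mi0 then u (mi_sub a b) else 0.
Proof.
rewrite smulE; case: ifPn => ba.
  rewrite (bigD1_seq (mi_sub a b)) ?below_uniq ?mem_below ?mi_sub_below//=.
  rewrite /monomial mi_subK// eqxx mulr1 big_seq_cond big1 ?addr0// => c /andP[cb ca].
  case: eqP => [e|_]; last by rewrite mulr0.
  by move: ca; rewrite -e mi_subK ?eqxx// -mem_below.
rewrite big_seq big1// => c ca; rewrite /monomial; case: eqP => [e|_].
  by move: ba; rewrite -e mi_sub_below.
by rewrite mulr0.
Qed.

Lemma poly_sum p (s : seq (mi n)) : uniq s -> (forall a, a \notin s -> p a = 0) ->
  p = (fun a => \sum_(b <- s) p b * mon b a).
Proof.
move=> us hs; apply/funext => a; have [as_|as_] := boolP (a \in s).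
  rewrite (bigD1_seq a)//= /monomial eqxx mulr1 big1 ?addr0// => b /negPf ba.
  by rewrite eq_sym ba mulr0.
rewrite hs// big_seq big1// => b bs; rewrite /monomial; case: eqP => [e|].
  by rewrite -e (negPf as_) in bs.
by rewrite mulr0.
Qed.

Lemma smul_sum u p (s : seq (mi n)) : uniq s -> (forall a, a \notin s -> p a = 0) ->
  smul u p = (fun a => \sum_(b <- s) p b * smul u (mon b) a).
Proof.
move=> us hs; apply/funext => a; rewrite smulE.
rewrite (eq_bigr (fun c => \sum_(b <- s) u c * (p b * mon b (mi_sub a c)))); last first.
  by move=> c _; rewrite {1}(poly_sum us hs) mulr_sumr.
rewrite exchange_big /=; apply: eq_bigr => b _; rewrite smulE mulr_sumr.
by apply: eq_bigr => c _; ring.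
Qed.

Lemma smul_mon0 u : smul u (mon mi0) = u.
Proof.
apply/funext => a; rewrite smul_mon mi_sub0 ifT//.
by apply/mi_sub_eq0P => i; rewrite ffunE.
Qed.

Lemma smul_mon_pred u b i : (0 < b i)%N ->
  smul u (mon b) = mulz i (smul u (mon (mi_pred i b))).
Proof.
move=> bi; apply/funext => a; rewrite /mulz !smul_mon.
have [ai|ai] := ltnP 0 (a i); first by rewrite !mi_sub_pred.
case: mi_sub_eq0P => // /(_ i); move: (a i) (b i) bi ai => x y; lia.
Qed.

(** Multiplication by z^b is a succession of multiplications by coordinates, each of which preserves
    the space. *)
Lemma inH_smul_mon u b : (0 < m)%N -> inH u -> inH (smul u (mon b)).
Proof.
move=> m0 hu; move: {2}(mdeg b).+1 (ltnSn (mdeg b)) => N; elim: N => // N IH in b *.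
have [->|/mi_neq0P[i bi]] := eqVneq b mi0; first by rewrite smul_mon0.
rewrite (smul_mon_pred u bi) ltnS (mdeg_pred bi) => /IH; exact: inH_mulz.
Qed.

(* The coefficient of z^a in T_u^* z^b. *)
Definition conj_mul_coef u a b : C :=
  if mi_sub a b == mi0 then rhoC a / rhoC b * conjc (u (mi_sub b a)) else 0.

(** The explicit formula for T_u^* p. Since p has finite support, only finitely many coefficients of
    u and v enter, and the identity is an exchange of finite sums. *)
Lemma ipH_smul_poly u v p (s : seq (mi n)) :
  uniq s -> (forall a, a \notin s -> p a = 0) ->
  ipH m (smul u v) p = ipH m v (fun a => \sum_(b <- s) p b * conj_mul_coef u a b).
Proof.
move=> us hs; rewrite (@ipH_seq _ _ _ s)//; last by move=> a /hs; right.
(* All indices below some index in s; outside them T_u^* p has zero coefficients. *)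
pose t := undup (flatten (map (@below n) s)).
have tP b a : b \in s -> a \in below b -> a \in t.
  move=> bs ab; rewrite mem_undup; apply/flattenP.
  by exists (below b) => //; exact: map_f.
rewrite (@ipH_seq _ _ _ t) ?undup_uniq// => [|a at_]; last first.
  right; rewrite big_seq big1// => b bs; rewrite /conj_mul_coef; case: ifP => ab.
    by move: at_; rewrite (tP b)// mem_below.
  by rewrite mulr0.
transitivity (\sum_(a <- t) \sum_(b <- s)
    (if a \in below b then v a * conjc (p b) * u (mi_sub b a) / rhoC b else 0)).
  rewrite exchange_big /=; rewrite !big_seq; apply: eq_bigr => b bs.
  rewrite -big_mkcond /= -big_filter.
  have pe : perm_eq [seq a <- t | a \in below b] (below b).
    apply: uniq_perm; rewrite ?below_uniq ?filter_uniq ?undup_uniq// => a.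
    by rewrite mem_filter andb_idr// => /(tP _ _ bs).
  (* Reindexing by a |-> b - a makes a the index of v and b - a that of u. *)
  rewrite (perm_big _ pe) -(perm_big _ (perm_below_sub b)) big_map smulE 2!mulr_suml.
  rewrite !big_seq; apply: eq_bigr => a; rewrite mem_below => ab.
  by rewrite mi_subK//; ring.
apply: eq_bigr => a _; rewrite conjc_sum mulr_sumr mulr_suml; apply: eq_bigr => b _.
rewrite mem_below conjcM /conj_mul_coef; case: ifP => ab; last first.
  by rewrite conjc0 !mulr0 mul0r.
rewrite !conjcM conjcV !conjc_rhoC conjcK.
by have := rhoC_neq0 R m a; have := rhoC_neq0 R m b => h1 h2; field; rewrite h1 h2.
Qed.

End Product.

(** * The rotation average and the identification of the symbol *)

Lemma weakAvg_one (R : realType) (n m : nat) (T T0 : hser R n -> hser R n) (a : mi n) :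
  isWeakAvg m T T0 ->
  T0 (@hone R n) a = if a == mi0 then T (@hone R n) a else 0.
Proof.
move=> /(_ (@hone R n) (monomial R a)); rewrite {1}hone_mon.
move=> /(_ (inH_mon R m _) (inH_mon R m _)).
(* As U(-t) fixes the constant 1, the integrand is e^{i|a|t} times a constant, and its mean vanishes
   unless a = 0. *)
rewrite ipH_monr (_ : (fun t => _) = (fun t : R =>
    Complex (cos (t * (mdeg a)%:R)) (sin (t * (mdeg a)%:R)) *
    (T (@hone R n) a / rhoC R m a))); last first.
  apply/funext => t; rewrite ipH_monr (_ : Ut (- t) (@hone R n) = @hone R n).
    by rewrite /Ut mulrA.
  apply/funext => b; rewrite /Ut /hone; case: eqP => [->|_]; last by rewrite mulr0.
  by rewrite mulr0 cos0 sin0 mulr1.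
rewrite cint_exp mdeg_eq0 => e.
apply: (mulIf (invr_neq0 (rhoC_neq0 R m a))); rewrite e.
case: ifP => _; last by rewrite mulr0 mul0r.
have pi2 : 2 * pi != 0 :> R by rewrite mulf_neq0// gt_eqF// pi_gt0.
rewrite mulrA (_ : _ * Complex (2 * pi) 0 = 1); first by rewrite mul1r.
by apply/eqP; rewrite eq_complex /= !mulr0 mul0r subr0 addr0 divfK// !eqxx.
Qed.

Theorem theorem4 (R : realType) (n m : nat) (hn : (1 <= n)%N) (hm : (1 <= m)%N)
  (T : hser R n -> hser R n) (hT : isBoundedOp m T)
  (Mzs : hser R n -> hvser R n) (hMzs : isAdjointVH m (@Mz R n) Mzs)
  (Mzs' : hser R n -> hvser R n) (hMzs' : isAdjointVH m (Mz' m) Mzs')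
  (P : hvser R n -> hvser R n) (hP : isOrthProjRange m Mzs P)
  (hyp : forall F, inHn m F -> Mzs' (T (Mz' m F)) = P (oplus (Ssum m Mzs T) (P F)))
  (T0 : hser R n -> hser R n) (hT0b : isBoundedOp m T0) (hT0 : isWeakAvg m T T0)
  (Ts : hser R n -> hser R n) (hTs : isAdjointH m T Ts) :
  let g : hser R n := fun a => T (@hone R n) a - T0 (@hone R n) a in
  let h : hser R n := Ts (@hone R n) in
  forall p : hser R n, isPoly p ->
    inH m (smul g p) /\ isTstarMul m h p (fun a => T p a - smul g p a).
Proof.
move=> g h p hp.
have lT : linearH m T by case: hT.
have hg : inH m g.
  apply: inHB; [case: hT|case: hT0b] => + _ _; apply; rewrite hone_mon;
  exact: inH_mon.
(* Removing T_0(1) takes away the constant term of T(1), which h already carries; otherwise the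
   diagonal of T would be counted twice. *)
have gE a : g a = if a == mi0 then 0 else T (monomial R mi0) a.
  by rewrite /g (weakAvg_one a hT0) hone_mon; case: ifP; rewrite ?subrr ?subr0.
(* From <T z^a, 1> = <z^a, h>: the first row of the scaled matrix is the conjugate of h. *)
have hE a : conjc (h a) = rhoC R m a * T (monomial R a) mi0.
  have [_ /(_ (monomial R a) (@hone R n) (inH_mon R m a))] := hTs.
  rewrite hone_mon -hone_mon => /(_ _)/[!hone_mon] -/(_ (inH_mon R m mi0)).
  rewrite ipH_monr ipH_monl rhoC0// invr1 mulr1 /h hone_mon => ->.
  by rewrite mulrC divfK// rhoC_neq0.
have TE a b : T (monomial R b) a = smul g (monomial R b) a + conj_mul_coef m h a b.
  have := congr1 (fun X => X a b) (mat_diag_sol hm hMzs hP lT hMzs' hyp).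
  rewrite /mat /diag_sol -rhoC_weight// => /(congr1 (fun x => x / rhoC R m b)).
  rewrite mulrAC mulfV ?rhoC_neq0// mul1r => ->.
  rewrite smul_mon /conj_mul_coef.
  (* For a <= b the entry comes from the first row, hence from h; this includes a = b, where g
     contributes its zero constant term. For b <= a with a != b it comes from the first column,
     hence from g, and incomparable pairs give 0. *)
  have [ab|ab] := boolP (mi_sub a b == mi0).
    rewrite (eqP ab) mi_min_l//= -hE.
    case: ifP => [ba|_]; last by rewrite add0r mulrAC.
    by rewrite gE eqxx add0r mulrAC.
  rewrite addr0 orFb; have [ba|ba] := boolP (mi_sub b a == mi0); last first.
    by rewrite mulr0 mul0r.
  rewrite mi_min_r// (eqP ba) rhoC0// mul1r mulrAC mulfV ?rhoC_neq0// mul1r.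
  by rewrite gE (negPf ab).
pose s : seq (mi n) := finmap.enum_fset (fset_set [set a | p a != 0]).
have us : uniq s by exact: finmap.fset_uniq.
have hs a : a \notin s -> p a = 0.
  by rewrite in_fset_set// => /negP; rewrite inE /= => /negP; rewrite negbK => /eqP.
have hgp : inH m (smul g p).
  by rewrite (smul_sum g us hs); apply: inH_sum => b; exact: inH_smul_mon.
split=> //; split.
  by apply: inHB => //; apply: (proj1 lT); exact: (@inH_seq _ _ _ s).
move=> v hv _; rewrite (ipH_smul_poly m h v us hs); congr (ipH _ _ _).
(* By linearity over the finite support of p, the identity reduces to the coefficients of T on
   monomials. *)
have -> := etrans (congr1 T (poly_sum us hs)) (linearH_sum s p lT (inH_mon R m)).
apply/funext => a; rewrite (smul_sum g us hs) -sumrB; apply: eq_bigr => b _.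
by rewrite TE; ring.
Qed.
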